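(* Let $M^2$ be a spacelike surface in $\mathbb R^4_1$ free of flat points. Then $M^2$ is minimal if and only if $\varkappa^2-k=0$ (at every point of $M^2$).
   Context: $\mathbb R^4_1$ is the four-dimensional Minkowski space with metric $\langle\,,\rangle$ of signature $(3,1)$, with a fixed orthonormal basis $e_1,e_2,e_3,e_4$, $e_1^2=e_2^2=e_3^2=1$, $e_4^2=-1$, giving the orientation. A surface $M^2: z=z(u,v)$, $(u,v)\in\mathcal D\subset\mathbb R^2$ (smooth immersion) is spacelike if the induced metric is Riemannian. Put $E=\langle z_u,z_u\rangle$, $F=\langle z_u,z_v\rangle$, $G=\langle z_v,z_v\rangle$, $W=\sqrt{EG-F^2}$. Choose a normal frame field $\{n_1,n_2\}$ with $\langle n_1,n_1\rangle=1$, $\langle n_2,n_2\rangle=-1$, $\langle n_1,n_2\rangle=0$, such that $\{z_u,z_v,n_1,n_2\}$ is positively oriented. Put $c_{11}^k=\langle z_{uu},n_k\rangle$, $c_{12}^k=\langle z_{uv},n_k\rangle$, $c_{22}^k=\langle z_{vv},n_k\rangle$ ($k=1,2$), $$\Delta_1=c_{11}^1c_{12}^2-c_{11}^2c_{12}^1,\quad \Delta_2=c_{11}^1c_{22}^2-c_{11}^2c_{22}^1,\quad \Delta_3=c_{12}^1c_{22}^2-c_{12}^2c_{22}^1,$$ $$L=\frac{2\Delta_1}{W},\quad M=\frac{\Delta_2}{W},\quad N=\frac{2\Delta_3}{W},\qquad k=\frac{LN-M^2}{EG-F^2},\quad \varkappa=\frac{EN+GL-2FM}{2(EG-F^2)}.$$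 A point is flat if $k=\varkappa=0$ there (equivalently $L=M=N=0$). $M^2$ is minimal if $H=0$ everywhere, where $H=\frac12(\sigma(x,x)+\sigma(y,y))$, $\sigma$ being the (normal-bundle-valued) second fundamental tensor and $\{x,y\}$ an orthonormal tangent frame. *)

(* Defs.v *)
From HB Require Import structures.
From mathcomp Require Import all_boot all_order all_algebra.
From mathcomp Require Import all_classical all_reals all_analysis.
From mathcomp Require Import ring.
Set Implicit Arguments.
Unset Strict Implicit.
Unset Printing Implicit Defensive.
Import Order.TTheory GRing.Theory Num.Theory.
Import numFieldNormedType.Exports.
Local Open Scope classical_set_scope.
Local Open Scope ring_scope.

(* The orthonormal basis e_1, ..., e_4 of R^4_1 is the standard basis of
   'rV[R]_4, with e_4 (index ord_max) timelike. *)
Definition mink (R : realType) (x y : 'rV[R]_4) : R :=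
  \sum_(i < 3) x 0 (widen_ord (leqnSn 3) i) * y 0 (widen_ord (leqnSn 3) i)
  - x 0 ord_max * y 0 ord_max.

Definition pos_oriented (R : realType) (a b c d : 'rV[R]_4) : Prop :=
  0 < \det (\matrix_(i < 4) nth 0 [:: a; b; c; d] i).

(* C^oo on D (meant for open D): every iterated directional derivative is
   Frechet differentiable at every point of D. *)
Definition smooth_on (R : realType) (D : set 'rV[R]_2)
    (f : 'rV[R]_2 -> 'rV[R]_4) : Prop :=
  forall (s : seq 'rV[R]_2) (p : 'rV[R]_2), D p ->
    differentiable (foldr (fun v g => fun q => 'D_v g q) f s) p.

Definition du (R : realType) (f : 'rV[R]_2 -> 'rV[R]_4) : 'rV[R]_2 -> 'rV[R]_4 :=
  fun p => 'D_(delta_mx 0 0) f p.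
Definition dv (R : realType) (f : 'rV[R]_2 -> 'rV[R]_4) : 'rV[R]_2 -> 'rV[R]_4 :=
  fun p => 'D_(delta_mx 0 1) f p.

(* A tangent vector at p is represented by its coordinates a : 'rV_2; as a
   vector of R^4_1 it is 'D_a z p = a_1 z_u + a_2 z_v. *)
Definition induced_metric (R : realType) (z : 'rV[R]_2 -> 'rV[R]_4)
    (p a b : 'rV[R]_2) : R :=
  mink ('D_a z p) ('D_b z p).

Definition spacelike_surface (R : realType) (D : set 'rV[R]_2)
    (z : 'rV[R]_2 -> 'rV[R]_4) : Prop :=
  [/\ open D,
      smooth_on D z,
      (forall p, D p -> injective ('d z p : 'rV[R]_2 -> 'rV[R]_4)) &
      forall p a, D p -> a != 0 -> 0 < induced_metric z p a a].

Definition coefE (R : realType) (z : 'rV[R]_2 -> 'rV[R]_4) p : R :=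
  mink (du z p) (du z p).
Definition coefF (R : realType) (z : 'rV[R]_2 -> 'rV[R]_4) p : R :=
  mink (du z p) (dv z p).
Definition coefG (R : realType) (z : 'rV[R]_2 -> 'rV[R]_4) p : R :=
  mink (dv z p) (dv z p).
Definition gram (R : realType) (z : 'rV[R]_2 -> 'rV[R]_4) p : R :=
  coefE z p * coefG z p - coefF z p ^+ 2.
Definition coefW (R : realType) (z : 'rV[R]_2 -> 'rV[R]_4) p : R :=
  Num.sqrt (gram z p).

Definition normal_frame (R : realType) (D : set 'rV[R]_2)
    (z n1 n2 : 'rV[R]_2 -> 'rV[R]_4) : Prop :=
  [/\ smooth_on D n1, smooth_on D n2 &
   forall p, D p ->
     [/\ mink (n1 p) (n1 p) = 1, mink (n2 p) (n2 p) = -1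
       & mink (n1 p) (n2 p) = 0] /\
     [/\ mink (du z p) (n1 p) = 0, mink (dv z p) (n1 p) = 0,
         mink (du z p) (n2 p) = 0 & mink (dv z p) (n2 p) = 0] /\
     pos_oriented (du z p) (dv z p) (n1 p) (n2 p)].

(* c11 z n p, c12 z n p, c22 z n p are the numbers c_{ij}^k for n = n_k. *)
Definition c11 (R : realType) (z n : 'rV[R]_2 -> 'rV[R]_4) p : R :=
  mink (du (du z) p) (n p).
Definition c12 (R : realType) (z n : 'rV[R]_2 -> 'rV[R]_4) p : R :=
  mink (dv (du z) p) (n p).
Definition c22 (R : realType) (z n : 'rV[R]_2 -> 'rV[R]_4) p : R :=
  mink (dv (dv z) p) (n p).

Definition Delta1 (R : realType) (z n1 n2 : 'rV[R]_2 -> 'rV[R]_4) p : R :=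
  c11 z n1 p * c12 z n2 p - c11 z n2 p * c12 z n1 p.
Definition Delta2 (R : realType) (z n1 n2 : 'rV[R]_2 -> 'rV[R]_4) p : R :=
  c11 z n1 p * c22 z n2 p - c11 z n2 p * c22 z n1 p.
Definition Delta3 (R : realType) (z n1 n2 : 'rV[R]_2 -> 'rV[R]_4) p : R :=
  c12 z n1 p * c22 z n2 p - c12 z n2 p * c22 z n1 p.

Definition coefL (R : realType) (z n1 n2 : 'rV[R]_2 -> 'rV[R]_4) p : R :=
  2 * Delta1 z n1 n2 p / coefW z p.
Definition coefM (R : realType) (z n1 n2 : 'rV[R]_2 -> 'rV[R]_4) p : R :=
  Delta2 z n1 n2 p / coefW z p.
Definition coefN (R : realType) (z n1 n2 : 'rV[R]_2 -> 'rV[R]_4) p : R :=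
  2 * Delta3 z n1 n2 p / coefW z p.

Definition inv_k (R : realType) (z n1 n2 : 'rV[R]_2 -> 'rV[R]_4) p : R :=
  (coefL z n1 n2 p * coefN z n1 n2 p - coefM z n1 n2 p ^+ 2) / gram z p.
Definition inv_kappa (R : realType) (z n1 n2 : 'rV[R]_2 -> 'rV[R]_4) p : R :=
  (coefE z p * coefN z n1 n2 p + coefG z p * coefL z n1 n2 p
   - 2 * coefF z p * coefM z n1 n2 p) / (2 * gram z p).

Definition flat_point (R : realType) (z n1 n2 : 'rV[R]_2 -> 'rV[R]_4) p : Prop :=
  inv_k z n1 n2 p = 0 /\ inv_kappa z n1 n2 p = 0.

(* Orthogonal projections onto the tangent plane span(z_u, z_v), through the
   inverse of the Gram matrix (E F; F G), and onto the normal plane. *)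
Definition tangent_part (R : realType) (z : 'rV[R]_2 -> 'rV[R]_4) p
    (w : 'rV[R]_4) : 'rV[R]_4 :=
  ((coefG z p * mink w (du z p) - coefF z p * mink w (dv z p)) / gram z p)
    *: du z p
  + ((coefE z p * mink w (dv z p) - coefF z p * mink w (du z p)) / gram z p)
    *: dv z p.
Definition normal_part (R : realType) (z : 'rV[R]_2 -> 'rV[R]_4) p
    (w : 'rV[R]_4) : 'rV[R]_4 :=
  w - tangent_part z p w.

Lemma minkC (R : realType) (x y : 'rV[R]_4) : mink x y = mink y x.
Proof.
by rewrite /mink; congr (_ - _); [apply: eq_bigr => i _|]; rewrite mulrC.
Qed.

Lemma mink_linearl (R : realType) (a x y : 'rV[R]_4) (s : R) :
  mink (s *: a + x) y = s * mink a y + mink x y.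
Proof.
rewrite /mink !mxE mulrDl opprD mulrBr -mulrA addrACA; congr (_ + _).
by rewrite mulr_sumr -big_split; apply: eq_bigr => i _; rewrite !mxE mulrDl -mulrA.
Qed.

Lemma solve_gram (K : fieldType) (a b E F G : K) : E * G - F ^+ 2 != 0 ->
  a = (G * a - F * b) / (E * G - F ^+ 2) * E
      + (E * b - F * a) / (E * G - F ^+ 2) * F /\
  b = (G * a - F * b) / (E * G - F ^+ 2) * F
      + (E * b - F * a) / (E * G - F ^+ 2) * G.
Proof. by move=> g0; split; field. Qed.

Lemma normal_part_orthogonal (R : realType) (z : 'rV[R]_2 -> 'rV[R]_4) p w :
  gram z p != 0 ->
  mink (normal_part z p w) (du z p) = 0 /\ mink (normal_part z p w) (dv z p) = 0.
Proof.
rewrite /normal_part /tangent_part /gram /coefE /coefF /coefG.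
move: (du z p) (dv z p) => X Y g0.
have lin s t y : mink (w - (s *: X + t *: Y)) y
    = mink w y - (s * mink X y + t * mink Y y).
  have -> : w - (s *: X + t *: Y) = (- s) *: X + ((- t) *: Y + w).
    by rewrite !scaleNr opprD addrC addrA.
  by rewrite !mink_linearl !mulNr opprD addrA addrC.
have [ha hb] := solve_gram (mink w X) (mink w Y) g0.
split; rewrite lin; apply/eqP; rewrite subr_eq0; apply/eqP => //.
by rewrite (minkC Y X).
Qed.

(* sigma(X, Y) is the normal part of the flat derivative of Y along X, where X
   and Y are the tangent fields with constant coordinates a and b. *)
Definition second_fundamental (R : realType) (z : 'rV[R]_2 -> 'rV[R]_4)
    (p a b : 'rV[R]_2) : 'rV[R]_4 :=
  normal_part z p ('D_a (fun q => 'D_b z q) p).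

Definition orthonormal_tangent_frame (R : realType) (z : 'rV[R]_2 -> 'rV[R]_4)
    (p x y : 'rV[R]_2) : Prop :=
  [/\ induced_metric z p x x = 1, induced_metric z p y y = 1
    & induced_metric z p x y = 0].

(* On orthonormal frames the value does not depend on the frame {x, y}. *)
Definition mean_curvature (R : realType) (z : 'rV[R]_2 -> 'rV[R]_4)
    (p x y : 'rV[R]_2) : 'rV[R]_4 :=
  2^-1 *: (second_fundamental z p x x + second_fundamental z p y y).

Definition minimal_surface (R : realType) (D : set 'rV[R]_2)
    (z : 'rV[R]_2 -> 'rV[R]_4) : Prop :=
  forall p x y, D p -> orthonormal_tangent_frame z p x y ->
    mean_curvature z p x y = 0.

(* Main.v *)
Require Import Defs.
From HB Require Import structures.
From mathcomp Require Import all_boot all_order all_algebra.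
From mathcomp Require Import all_classical all_reals all_analysis.
From mathcomp Require Import ring lra.
Set Implicit Arguments.
Unset Strict Implicit.
Unset Printing Implicit Defensive.
Import Order.TTheory GRing.Theory Num.Theory.
Import numFieldNormedType.Exports.
Local Open Scope classical_set_scope.
Local Open Scope ring_scope.

(** The statement is pointwise, so fix p and write h_k = G c11^k - 2 F c12^k +
    E c22^k for the trace of the k-th component of the second fundamental form,
    up to the factor EG - F^2. The proof joins two equivalences.

    Geometry: H = 0 at p if and only if h_1 = h_2 = 0. For an orthonormal frame
    {x, y} the matrix x x^T + y y^T is the inverse of the first fundamental
    form [orthonormal_trace], hence 2 (EG - F^2) <H, n_k> = h_k
    [mink_mean_curvature]; and H, being orthogonal to z_u and z_v, is determined
    by its products with n_1 and n_2. Expanding sigma(x, x) in coordinates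
    requires z_uv = z_vu, which is proved here for directional derivatives that
    are differentiable at the point [derive_commute].

    Algebra: as the first fundamental form is definite, kappa^2 - k is, up to a
    positive factor, a sum of squares, and it vanishes exactly when (L, M, N) is
    proportional to (E, F, G) [umbilic_discriminant]. With c_ij = (c_ij^1,
    c_ij^2) and h = (h_1, h_2), the two conditions of proportionality say that h
    is parallel to c_11 and to c_12, so Delta_1 h = 0. If h were nonzero, then
    Delta_1 = 0, so L = 0, hence M = N = 0 by proportionality, and the point
    would be flat [trace_zero_iff]. *)

(** * Symmetry of second derivatives *)

Lemma is_derive_line (R : realType) (V W : normedModType R) (f : V -> W)
    (q u : V) (t : R) (df : W) :
  is_derive (t *: u + q) u f df ->
  is_derive t (1 : R) (fun s : R => f (s *: u + q)) df.
Proof.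
have growth : (fun h : R => h^-1 *: (f ((h *: (1 : R) + t) *: u + q) - f (t *: u + q)))
    = (fun h : R => h^-1 *: (f (h *: u + (t *: u + q)) - f (t *: u + q))).
  by apply/funext => h; rewrite [h *: 1]mulr1 scalerDl addrA.
move=> [fu <-]; split; last by rewrite /derive /= growth.
by rewrite /derivable /= growth.
Qed.

Lemma diff_remainder_le (R : realType) (V W : normedModType R) (f : V -> W)
    (p : V) (e : R) : differentiable f p -> 0 < e ->
  \forall w \near 0, `|f (w + p) - f p - 'd f p w| <= e * `|w|.
Proof.
move=> df e0; have /(eqaddoP _ _ _ _).1 rem := diff_locally df.
by apply: filterS (rem e e0) => w; rewrite !fctE /= opprD addrA.
Qed.

(** The mean value theorem in the direction u turns the second difference over
    the parallelogram spanned by h u and h v into h times a difference of fu at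
    two points that differ by h v. The increments of fu from p to both points
    are then known up to o(h), because fu is differentiable at p. The limit
    involves fu and v only, although the second difference is symmetric in u and
    v. *)
Lemma second_difference_cvg (R : realType) (V : normedModType R)
    (f fu : V -> R) (p u v : V) :
  (\forall q \near p, is_derive q u f (fu q)) -> differentiable fu p ->
  (fun h : R => (h ^+ 2)^-1 *
    (f (h *: u + (h *: v + p)) - f (h *: u + p) - f (h *: v + p) + f p))
    @ 0^'+ --> 'D_v fu p.
Proof.
move=> df dfu; rewrite (deriveE _ dfu); apply/cvgrPdist_le => /= e e0.
(* Points of the parallelogram are within h * (c / 2) of p, so each of the two
   remainders is at most e * h / 2. *)
pose c := 2 * (`|u| + `|v| + 1).
have c0 : 0 < c by rewrite mulr_gt0// ltr_wpDl ?addr_ge0.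
have ec0 : 0 < e / c by rewrite divr_gt0.
have /nbhs_norm0P[r /= r0 near_p] : \forall w \near 0,
    is_derive (w + p) u f (fu (w + p)) /\
    `|fu (w + p) - fu p - 'd fu p w| <= e / c * `|w|.
  apply: filterI; last exact: diff_remainder_le.
  by move: df; rewrite (near_shift 0) /= subr0.
near=> h.
have h0 : 0 < h by [].
have hr : h * c < r.
  by rewrite -ltr_pdivlMr//; near: h; apply: nbhs_right_lt; rewrite divr_gt0.
have small (t s : R) : 0 <= t <= h -> 0 <= s <= h ->
    `|t *: u + s *: v| <= h * (c / 2) /\ `|t *: u + s *: v| < r.
  move=> /andP[t0 th] /andP[s0 sh].
  have le1 : `|t *: u + s *: v| <= h * (c / 2).
    rewrite (le_trans (ler_normD _ _))// !normrZ !ger0_norm// /c.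
    have := ler_wpM2r (normr_ge0 u) th; have := ler_wpM2r (normr_ge0 v) sh.
    by move: h0; lra.
  split=> //; apply: le_lt_trans le1 _; apply: le_lt_trans hr.
  by rewrite ler_pM2l//; lra.
have h0h : 0 <= h <= h by rewrite lexx ltW.
have z0h : (0 : R) <= 0 <= h by rewrite lexx ltW.
pose phi (t : R) := f (t *: u + (h *: v + p)) - f (t *: u + p).
pose dphi (t : R) := fu (t *: u + (h *: v + p)) - fu (t *: u + p).
have dphiP (t : R) : 0 <= t <= h -> is_derive t (1 : R) phi (dphi t).
  move=> th; apply: is_deriveB; apply: is_derive_line.
    by rewrite addrA; apply: (near_p _ _).1; exact: (small t h _ _).2.
  have := (small t 0 th z0h).2; rewrite scale0r addr0 => tr.
  exact: (near_p _ tr).1.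
have [x xh phiE] : exists2 x, x \in `]0, h[ & phi h - phi 0 = dphi x * (h - 0).
  apply: MVT => // [t /[!in_itv]/= /andP[t0 th]|].
    by apply: dphiP; rewrite !ltW.
  apply: derivable_within_continuous => t /[!in_itv]/= th.
  by have [] := dphiP t th.
have {}xh : 0 <= x <= h by move: xh; rewrite in_itv/= => /andP[? ?]; rewrite !ltW.
have -> : f (h *: u + (h *: v + p)) - f (h *: u + p) - f (h *: v + p) + f p
    = h * dphi x.
  by move: phiE; rewrite subr0 [RHS]mulrC /phi scale0r !add0r => <-; ring.
have [s1 s1r] := small x h xh h0h; have [s2 s2r] := small x 0 xh z0h.
have [_ b1] := near_p _ s1r; have [_ b2] := near_p _ s2r.
have {}b1 := le_trans b1 (ler_wpM2l (ltW ec0) s1).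
have {}b2 := le_trans b2 (ler_wpM2l (ltW ec0) s2).
have boundE : e / c * (h * (c / 2)) = e * h / 2 by field; rewrite gt_eqF.
rewrite boundE linearD !linearZ /= -[x *: u + _ + p]addrA in b1.
rewrite boundE scale0r addr0 linearZ /= in b2.
have -> : 'd fu p v - (h ^+ 2)^-1 * (h * dphi x)
    = h^-1 * (h * 'd fu p v - dphi x) by field; rewrite gt_eqF.
rewrite normrM ger0_norm ?invr_ge0 ?(ltW h0)// ler_pdivrMl// [h * e]mulrC.
have -> : e * h = e * h / 2 + e * h / 2 by field.
apply: le_trans (lerD b1 b2); apply: le_trans (ler_normB _ _).
rewrite distrC /dphi le_eqVlt; apply/orP; left; apply/eqP; congr `|_|.
by rewrite /GRing.scale /=; ring.
Unshelve. all: by end_near. Qed.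

(** Schwarz theorem: both sides are the limit of the same second difference. The
    derivatives fu and fv are separate functions because they need only agree
    with the derivatives of f near p. *)
Lemma derive_commute (R : realType) (V : normedModType R)
    (f fu fv : V -> R) (p u v : V) :
  (\forall q \near p, is_derive q u f (fu q)) ->
  (\forall q \near p, is_derive q v f (fv q)) ->
  differentiable fu p -> differentiable fv p ->
  'D_v fu p = 'D_u fv p.
Proof.
move=> fuP fvP dfu dfv.
have cu := second_difference_cvg (v := v) fuP dfu.
have cv := second_difference_cvg (v := u) fvP dfv.
have swap : (fun h : R => (h ^+ 2)^-1 *
      (f (h *: v + (h *: u + p)) - f (h *: v + p) - f (h *: u + p) + f p)) =
    (fun h : R => (h ^+ 2)^-1 *
      (f (h *: u + (h *: v + p)) - f (h *: u + p) - f (h *: v + p) + f p)).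
  by apply/funext => h; rewrite addrCA; congr (_ * _); ring.
rewrite swap in cv; apply: (cvg_unique (@norm_hausdorff R R) cu cv).
Qed.

Lemma derive_commute_mx (R : realType) (V : normedModType R) m n
    (f : V -> 'M[R]_(m, n)) (p u v : V) :
  (\forall q \near p, differentiable f q) ->
  differentiable ('D_u f) p -> differentiable ('D_v f) p ->
  'D_v ('D_u f) p = 'D_u ('D_v f) p.
Proof.
move=> df dfu dfv.
have entry (g : V -> 'M[R]_(m, n)) i j : differentiable g p ->
    differentiable (fun x => g x i j : R) p.
  move=> dg; pose c (N : 'M[R]_(m, n)) : R := N i j.
  by apply: (@differentiable_comp _ _ _ _ g c p dg); exact: differentiable_coord.
have is_derive_entry a i j : \forall q \near p,
    is_derive q a (fun x => f x i j : R) ('D_a f q i j).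
  apply: filterS df => q /(diff_derivable (v := a)) dq.
  by split; [move/derivable_mxP : dq|rewrite derive_mx// mxE].
have derive_entry (g : V -> 'M[R]_(m, n)) a i j : differentiable g p ->
    'D_a g p i j = 'D_a (fun x => g x i j : R) p.
  by move=> /(diff_derivable (v := a)) dg; rewrite [in LHS]derive_mx// mxE.
apply/matrixP => i j.
transitivity ('D_v (fun x => 'D_u f x i j : R) p); first exact: derive_entry.
transitivity ('D_u (fun x => 'D_v f x i j : R) p); last first.
  by apply/esym; exact: derive_entry.
exact: (derive_commute (is_derive_entry u i j) (is_derive_entry v i j)
  (entry _ i j dfu) (entry _ i j dfv)).
Qed.

(** * Algebra of the two fundamental forms *)

(** In a basis orthonormal for the first form this is
    (L + N)^2 - 4 (LN - M^2) = (L - N)^2 + 4 M^2; the identity [sos] is its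
    version for a general basis, obtained by completing the square with E > 0. *)
Lemma umbilic_discriminant (R : realFieldType) (E F G L M N : R) :
  0 < E -> 0 < E * G - F ^+ 2 ->
  ((E * N + G * L - 2 * F * M) / (2 * (E * G - F ^+ 2))) ^+ 2
    - (L * N - M ^+ 2) / (E * G - F ^+ 2) = 0 <->
  E * M = F * L /\ E * N = G * L.
Proof.
move=> E0 g0.
have sos : ((E * N + G * L - 2 * F * M) / (2 * (E * G - F ^+ 2))) ^+ 2
    - (L * N - M ^+ 2) / (E * G - F ^+ 2)
  = ((E * (E * N - G * L) - 2 * F * (E * M - F * L)) ^+ 2
     + 4 * (E * G - F ^+ 2) * (E * M - F * L) ^+ 2)
    / (2 * E * (E * G - F ^+ 2)) ^+ 2.
  by field; rewrite !gt_eqF.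
rewrite {}sos; split=> [/eqP|[-> ->]]; last first.
  by rewrite !subrr; field; rewrite !gt_eqF.
rewrite mulf_eq0 invr_eq0 expf_eq0 /= [X in _ || X]gt_eqF ?mulr_gt0// orbF.
have gE : 0 < 4 * (E * G - F ^+ 2) by rewrite mulr_gt0.
rewrite paddr_eq0 ?sqr_ge0 ?(mulr_ge0 (ltW gE) (sqr_ge0 _))//.
rewrite expf_eq0 /= => /andP[s1].
rewrite mulf_eq0 (gt_eqF gE) expf_eq0 /= => /eqP EM.
move: s1; rewrite EM mulr0 subr0 mulf_eq0 (gt_eqF E0) /= => /eqP EN.
by split; apply/eqP; rewrite -subr_eq0; apply/eqP.
Qed.

(** Here (a_k, b_k, c_k) stands for (c11^k, c12^k, c22^k). Up to factors, the
    proportionality conditions for (L, M, N) are the two linear equations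
    a_1 h_2 - a_2 h_1 = 0 and b_1 h_2 - b_2 h_1 = 0 in (h_1, h_2), whose
    determinant is Delta_1; Cramer's rule gives Delta_1 h = 0. *)
Lemma trace_zero_iff (R : realFieldType) (E F G W a1 b1 c1 a2 b2 c2 : R) :
  0 < E -> 0 < E * G - F ^+ 2 -> 0 < W ->
  let L := 2 * (a1 * b2 - a2 * b1) / W in
  let M := (a1 * c2 - a2 * c1) / W in
  let N := 2 * (b1 * c2 - b2 * c1) / W in
  let k := (L * N - M ^+ 2) / (E * G - F ^+ 2) in
  let kappa := (E * N + G * L - 2 * F * M) / (2 * (E * G - F ^+ 2)) in
  ~ (k = 0 /\ kappa = 0) ->
  (G * a1 - 2 * F * b1 + E * c1 = 0 /\ G * a2 - 2 * F * b2 + E * c2 = 0) <->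
  kappa ^+ 2 - k = 0.
Proof.
move=> E0 g0 W0 L M N k kappa nflat.
set h1 := G * a1 - _ + _; set h2 := G * a2 - _ + _.
apply: iff_trans (iff_sym (umbilic_discriminant L M N E0 g0)).
have EM : E * M - F * L = (a1 * h2 - a2 * h1) / W.
  by rewrite /L /M /h1 /h2; field; rewrite gt_eqF.
have EN : E * N - G * L = 2 * (b1 * h2 - b2 * h1) / W.
  by rewrite /L /N /h1 /h2; field; rewrite gt_eqF.
split=> [[h10 h20]|[/eqP+ /eqP]].
  by split; apply/eqP; rewrite -subr_eq0 ?EM ?EN h10 h20 !mulr0 subrr ?mulr0 mul0r.
rewrite -!(subr_eq0 (E * _)) EM EN.
have W'0 : W^-1 == 0 = false by rewrite invr_eq0 gt_eqF.
rewrite !mulf_eq0 W'0 pnatr_eq0 /= !orbF => /eqP ah /eqP bh.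
have d1 : (a1 * b2 - a2 * b1) * h1 = 0.
  have -> : (a1 * b2 - a2 * b1) * h1
      = b1 * (a1 * h2 - a2 * h1) - a1 * (b1 * h2 - b2 * h1) by ring.
  by rewrite ah bh; ring.
have d2 : (a1 * b2 - a2 * b1) * h2 = 0.
  have -> : (a1 * b2 - a2 * b1) * h2
      = b2 * (a1 * h2 - a2 * h1) - a2 * (b1 * h2 - b2 * h1) by ring.
  by rewrite ah bh; ring.
have [d0|d0] := eqVneq (a1 * b2 - a2 * b1) 0; last first.
  by split; apply/eqP; [move/eqP: d1|move/eqP: d2]; rewrite mulf_eq0 (negPf d0).
have L0 : L = 0 by rewrite /L d0 mulr0 mul0r.
have M0 : M = 0.
  move/eqP: EM; rewrite L0 ah mulr0 mul0r subr0 mulf_eq0 (gt_eqF E0).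
  by move/eqP.
have N0 : N = 0.
  move/eqP: EN; rewrite L0 bh !mulr0 mul0r subr0 mulf_eq0 (gt_eqF E0).
  by move/eqP.
by case: nflat; rewrite /k /kappa L0 M0 N0 !(mulr0, mul0r, expr0n, subr0, addr0).
Qed.

(** If P is the matrix with rows x and y, and S = (E F; F G), then P S P^T = 1
    forces P^T P = S^-1. With the determinant d of P this reads
    P^T P = d^2 (G -F; -F E) and d^2 det S = 1, which avoids division. *)
Lemma orthonormal_trace (R : comPzRingType) (E F G a b c x1 x2 y1 y2 : R) :
  E * x1 ^+ 2 + 2 * F * x1 * x2 + G * x2 ^+ 2 = 1 ->
  E * y1 ^+ 2 + 2 * F * y1 * y2 + G * y2 ^+ 2 = 1 ->
  E * x1 * y1 + F * (x1 * y2 + x2 * y1) + G * x2 * y2 = 0 ->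
  (a * x1 ^+ 2 + 2 * b * x1 * x2 + c * x2 ^+ 2)
  + (a * y1 ^+ 2 + 2 * b * y1 * y2 + c * y2 ^+ 2)
  = (x1 * y2 - x2 * y1) ^+ 2 * (G * a - 2 * F * b + E * c)
  /\ (x1 * y2 - x2 * y1) ^+ 2 * (E * G - F ^+ 2) = 1.
Proof.
set Qx := E * x1 ^+ 2 + _ + _; set Qy := E * y1 ^+ 2 + _ + _.
set Qxy := E * x1 * y1 + _ + _ => Qx1 Qy1 Qxy0.
(* The entries of P^T P, from Q at y_i x - x_i y: these vectors lie on the
   coordinate axes, where Q is read off. *)
have g11 : x1 ^+ 2 + y1 ^+ 2 = (x1 * y2 - x2 * y1) ^+ 2 * G.
  transitivity (x1 ^+ 2 * Qy - 2 * x1 * y1 * Qxy + y1 ^+ 2 * Qx).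
    by rewrite Qx1 Qy1 Qxy0; ring.
  by rewrite /Qx /Qy /Qxy; ring.
have g12 : x1 * x2 + y1 * y2 = - ((x1 * y2 - x2 * y1) ^+ 2 * F).
  transitivity (x1 * x2 * Qy - (x1 * y2 + x2 * y1) * Qxy + y1 * y2 * Qx).
    by rewrite Qx1 Qy1 Qxy0; ring.
  by rewrite /Qx /Qy /Qxy; ring.
have g22 : x2 ^+ 2 + y2 ^+ 2 = (x1 * y2 - x2 * y1) ^+ 2 * E.
  transitivity (x2 ^+ 2 * Qy - 2 * x2 * y2 * Qxy + y2 ^+ 2 * Qx).
    by rewrite Qx1 Qy1 Qxy0; ring.
  by rewrite /Qx /Qy /Qxy; ring.
split.
  transitivity (a * (x1 ^+ 2 + y1 ^+ 2) + 2 * b * (x1 * x2 + y1 * y2)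
    + c * (x2 ^+ 2 + y2 ^+ 2)); first by ring.
  by rewrite g11 g12 g22; ring.
transitivity (Qx * Qy - Qxy ^+ 2); first by rewrite /Qx /Qy /Qxy; ring.
by rewrite Qx1 Qy1 Qxy0; ring.
Qed.

(** * The Minkowski product *)

Lemma minkDl (R : realType) (a b y : 'rV[R]_4) :
  mink (a + b) y = mink a y + mink b y.
Proof. by rewrite -[a]scale1r mink_linearl mul1r scale1r. Qed.

Lemma mink0l (R : realType) (y : 'rV[R]_4) : mink 0 y = 0.
Proof. by apply: (addrI (mink 0 y)); rewrite -minkDl !addr0. Qed.

Lemma minkZl (R : realType) (a y : 'rV[R]_4) s : mink (s *: a) y = s * mink a y.
Proof. by rewrite -[s *: a]addr0 mink_linearl mink0l addr0. Qed.

Lemma minkNl (R : realType) (a y : 'rV[R]_4) : mink (- a) y = - mink a y.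
Proof. by rewrite -scaleN1r minkZl mulN1r. Qed.

(** The four products are the entries of A w', where A has rows a, b, c, d and w'
    is w with its timelike entry negated; A is invertible by orientation. *)
Lemma mink_nondegenerate (R : realType) (a b c d w : 'rV[R]_4) :
  pos_oriented a b c d ->
  mink w a = 0 -> mink w b = 0 -> mink w c = 0 -> mink w d = 0 -> w = 0.
Proof.
rewrite /pos_oriented; set A := \matrix_(i < 4) _ => detA wa wb wc wd.
pose w' : 'rV[R]_4 := \row_j (if j == ord_max then - w 0 j else w 0 j).
have minkE y : mink w y = (w' *m y^T) 0 0.
  rewrite /mink mxE [RHS]big_ord_recr /w' /= !mxE eqxx mulNr; congr (_ - _).
  apply: eq_bigr => i _; rewrite !mxE ifN //.
  by rewrite -val_eqE /= neq_ltn ltn_ord.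
have w'A : A *m w'^T = 0.
  apply/matrixP => i j; rewrite !ord1 [RHS]mxE.
  transitivity (mink w (nth 0 [:: a; b; c; d] i)).
    by rewrite minkE !mxE; apply: eq_bigr => l _; rewrite !mxE mulrC.
  by case: i => -[|[|[|[|]]]].
have Au : A \in unitmx by rewrite unitmxE unitfE gt_eqF.
have w'0 : w' = 0.
  by apply: trmx_inj; rewrite -[w'^T](mulKmx Au) w'A mulmx0 trmx0.
apply/rowP => j; move/rowP : w'0 => /(_ j); rewrite !mxE.
by case: ifP => // _ /eqP; rewrite oppr_eq0 => /eqP.
Qed.

(** * Tangent frames and the mean curvature vector *)

Lemma derive_coordinates (R : realType) (f : 'rV[R]_2 -> 'rV[R]_4) p a :
  differentiable f p -> 'D_a f p = a 0 0 *: du f p + a 0 1 *: dv f p.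
Proof.
move=> df; rewrite /du /dv !(deriveE _ df) -!linearZ -linearD; congr ('d f p _).
rewrite [LHS]row_sum_delta big_ord_recl big_ord1; congr (_ + a 0 _ *: delta_mx 0 _);
  exact: val_inj.
Qed.

Lemma smooth_on_differentiable (R : realType) (D : set 'rV[R]_2)
    (f : 'rV[R]_2 -> 'rV[R]_4) p : smooth_on D f -> D p -> differentiable f p.
Proof. by move=> fs Dp; exact: (fs [::]). Qed.

Lemma smooth_on_derive (R : realType) (D : set 'rV[R]_2)
    (f : 'rV[R]_2 -> 'rV[R]_4) a p : smooth_on D f -> D p ->
  differentiable ('D_a f) p.
Proof. by move=> fs Dp; exact: (fs [:: a]). Qed.

Lemma derive_combination (R : realType) (V W : normedModType R) (f g : V -> W)
    (s t : R) p b : derivable f p b -> derivable g p b ->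
  'D_b (s *: f + t *: g) p = s *: 'D_b f p + t *: 'D_b g p.
Proof.
move=> df dg; rewrite (deriveD (derivableZ df) (derivableZ dg)).
by rewrite (deriveZ _ df) (deriveZ _ dg).
Qed.

Lemma second_derivative_coordinates (R : realType) (D : set 'rV[R]_2)
    (z : 'rV[R]_2 -> 'rV[R]_4) p a :
  open D -> smooth_on D z -> D p ->
  'D_a (fun q => 'D_a z q) p = a 0 0 ^+ 2 *: du (du z) p
    + (2 * a 0 0 * a 0 1) *: dv (du z) p + a 0 1 ^+ 2 *: dv (dv z) p.
Proof.
move=> oD sz Dp.
have Dnear : \forall q \near p, D q by exact: open_nbhs_nbhs.
have dz : \forall q \near p, differentiable z q.
  by apply: filterS Dnear => q; exact: smooth_on_differentiable.
have ddu : differentiable (du z) p := smooth_on_derive (delta_mx 0 0) sz Dp.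
have ddv : differentiable (dv z) p := smooth_on_derive (delta_mx 0 1) sz Dp.
have schwarz : du (dv z) p = dv (du z) p := esym (derive_commute_mx dz ddu ddv).
have nearE : \forall q \near p, 'D_a z q = (a 0 0 *: du z + a 0 1 *: dv z) q.
  by apply: filterS dz => q; exact: derive_coordinates.
have partial b : 'D_b (fun q => 'D_a z q) p
    = a 0 0 *: 'D_b (du z) p + a 0 1 *: 'D_b (dv z) p :=
  etrans (near_eq_derive b nearE) (derive_combination (a 0 0) (a 0 1)
    (diff_derivable (v := b) ddu) (diff_derivable (v := b) ddv)).
have pu : du (fun q => 'D_a z q) p = a 0 0 *: du (du z) p + a 0 1 *: dv (du z) p.
  by rewrite -schwarz; exact: partial.
have pv : dv (fun q => 'D_a z q) p = a 0 0 *: dv (du z) p + a 0 1 *: dv (dv z) p.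
  exact: partial.
have collect (s t : R) (A B C P Q : 'rV[R]_4) :
    P = s *: A + t *: B -> Q = s *: B + t *: C ->
    s *: P + t *: Q = s ^+ 2 *: A + (2 * s * t) *: B + t ^+ 2 *: C.
  move=> -> ->; rewrite !scalerDr !scalerA addrA -[_ + _ + _ *: B]addrA -scalerDl.
  by congr (_ *: _ + _ *: _ + _ *: _); ring.
have expand := derive_coordinates a (smooth_on_derive a sz Dp).
exact (etrans expand (collect (a 0 0) (a 0 1)
  (du (du z) p) (dv (du z) p) (dv (dv z) p) _ _ pu pv)).
Qed.

Lemma induced_metric_coordinates (R : realType) (z : 'rV[R]_2 -> 'rV[R]_4) p a b :
  differentiable z p ->
  induced_metric z p a b = Defs.coefE z p * a 0 0 * b 0 0
    + coefF z p * (a 0 0 * b 0 1 + a 0 1 * b 0 0) + coefG z p * a 0 1 * b 0 1.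
Proof.
move=> dz; rewrite /induced_metric !derive_coordinates// /Defs.coefE /coefF /coefG.
move: (du z p) (dv z p) => X Y.
rewrite minkDl !minkZl ![mink _ (_ + _)]minkC !minkDl !minkZl (minkC Y X); ring.
Qed.

Lemma spacelike_gram_gt0 (R : realType) (D : set 'rV[R]_2)
    (z : 'rV[R]_2 -> 'rV[R]_4) p :
  spacelike_surface D z -> D p -> 0 < Defs.coefE z p /\ 0 < gram z p.
Proof.
move=> [oD sz _ pos] Dp.
have dz := smooth_on_differentiable sz Dp.
have quad_gt0 (s t : R) : (s != 0) || (t != 0) ->
    0 < Defs.coefE z p * s ^+ 2 + 2 * coefF z p * s * t + coefG z p * t ^+ 2.
  move=> st; pose a : 'rV[R]_2 := \row_j (if j == 0 then s else t).
  have a0 : a != 0.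
    apply: contraL st => /eqP/rowP a0.
    by have := a0 0; have := a0 1; rewrite !mxE /= => -> ->; rewrite eqxx.
  have := pos p a Dp a0; rewrite induced_metric_coordinates// !mxE /=.
  by congr (0 < _); ring.
have E0 : 0 < Defs.coefE z p.
  by have := quad_gt0 1 0; rewrite oner_neq0 => /(_ isT); congr (0 < _); ring.
split=> //; rewrite -(pmulr_rgt0 _ E0).
(* The tangent vector E z_v - F z_u is orthogonal to z_u and has square
   E (EG - F^2). *)
have := quad_gt0 (- coefF z p) (Defs.coefE z p); rewrite (gt_eqF E0) orbT => /(_ isT).
by rewrite /gram; congr (0 < _); ring.
Qed.

(** Gram-Schmidt applied to (z_u, z_v). Minimality speaks of all orthonormal
    frames, so without one it would say nothing about the point. *)
Lemma orthonormal_tangent_frame_exists (R : realType)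
    (z : 'rV[R]_2 -> 'rV[R]_4) p :
  differentiable z p -> 0 < Defs.coefE z p -> 0 < gram z p ->
  exists x y, orthonormal_tangent_frame z p x y.
Proof.
move=> dz E0 g0.
pose r := Num.sqrt (Defs.coefE z p); pose s := Num.sqrt (Defs.coefE z p * gram z p).
have r2 : r ^+ 2 = Defs.coefE z p by rewrite sqr_sqrtr// ltW.
have s2 : s ^+ 2 = Defs.coefE z p * gram z p by rewrite sqr_sqrtr// ltW// mulr_gt0.
have r0 : r != 0 by rewrite sqrtr_eq0 -ltNge.
have s0 : s != 0 by rewrite sqrtr_eq0 -ltNge mulr_gt0.
exists (\row_j (if j == 0 then r^-1 else 0)).
exists (\row_j (if j == 0 then - coefF z p / s else Defs.coefE z p / s)).
split; rewrite induced_metric_coordinates// !mxE /=.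
- by rewrite -r2; field.
- transitivity (Defs.coefE z p * gram z p / s ^+ 2); first by rewrite /gram; field.
  by rewrite -s2 divff// expf_neq0.
- by field; rewrite r0 s0.
Qed.

Lemma mink_normal_part (R : realType) (z : 'rV[R]_2 -> 'rV[R]_4) p w n :
  mink (du z p) n = 0 -> mink (dv z p) n = 0 ->
  mink (normal_part z p w) n = mink w n.
Proof.
have orth (X Y : 'rV[R]_4) (s t : R) : mink X n = 0 -> mink Y n = 0 ->
    mink (w - (s *: X + t *: Y)) n = mink w n.
  move=> Xn Yn; rewrite minkDl minkNl minkDl !minkZl Xn Yn.
  by rewrite !mulr0 addr0 subr0.
move=> un vn; exact (orth _ _ _ _ un vn).
Qed.

Lemma mink_midpoint (R : realType) (a b n : 'rV[R]_4) :
  mink (2^-1 *: (a + b)) n = 2^-1 * (mink a n + mink b n).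
Proof. by rewrite minkZl minkDl. Qed.

(** The right-hand side is free of x and y: the mean curvature vector does not
    depend on the orthonormal frame. *)
Lemma mink_mean_curvature (R : realType) (D : set 'rV[R]_2)
    (z : 'rV[R]_2 -> 'rV[R]_4) p x y n :
  spacelike_surface D z -> D p -> orthonormal_tangent_frame z p x y ->
  mink (du z p) (n p) = 0 -> mink (dv z p) (n p) = 0 ->
  2 * gram z p * mink (mean_curvature z p x y) (n p)
  = coefG z p * c11 z n p - 2 * coefF z p * c12 z n p + Defs.coefE z p * c22 z n p.
Proof.
move=> hz Dp [xx yy xy] un vn; have [oD sz _ _] := hz.
have dz := smooth_on_differentiable sz Dp.
have sigma a : mink (second_fundamental z p a a) (n p) = c11 z n p * a 0 0 ^+ 2
    + 2 * c12 z n p * a 0 0 * a 0 1 + c22 z n p * a 0 1 ^+ 2.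
  have expand (s t : R) (A B C N : 'rV[R]_4) :
      mink (s ^+ 2 *: A + (2 * s * t) *: B + t ^+ 2 *: C) N
      = mink A N * s ^+ 2 + 2 * mink B N * s * t + mink C N * t ^+ 2.
    by rewrite !minkDl !minkZl; ring.
  apply: etrans (mink_normal_part _ un vn) _.
  rewrite (second_derivative_coordinates a oD sz Dp).
  exact (expand _ _ _ _ _ _).
have [|||tr det1] := @orthonormal_trace R (Defs.coefE z p) (coefF z p) (coefG z p)
  (c11 z n p) (c12 z n p) (c22 z n p) (x 0 0) (x 0 1) (y 0 0) (y 0 1).
- by rewrite -[RHS]xx induced_metric_coordinates//; ring.
- by rewrite -[RHS]yy induced_metric_coordinates//; ring.
- by rewrite -[RHS]xy induced_metric_coordinates//; ring.
have -> := etrans (mink_midpoint _ _ _)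
  (congr1 (fun t => 2^-1 * t) (congr2 +%R (sigma x) (sigma y))).
rewrite tr; apply: etrans (etrans (congr1 ( *%R^~ _) det1) (mul1r _)).
by rewrite /gram /=; field.
Qed.

Lemma mean_curvature_eq0 (R : realType) (D : set 'rV[R]_2)
    (z n1 n2 : 'rV[R]_2 -> 'rV[R]_4) p x y :
  spacelike_surface D z -> normal_frame D z n1 n2 -> D p ->
  orthonormal_tangent_frame z p x y ->
  mean_curvature z p x y = 0 <->
  coefG z p * c11 z n1 p - 2 * coefF z p * c12 z n1 p + Defs.coefE z p * c22 z n1 p = 0
  /\ coefG z p * c11 z n2 p - 2 * coefF z p * c12 z n2 p
     + Defs.coefE z p * c22 z n2 p = 0.
Proof.
move=> hz [_ _ frame] Dp xy.
have [_ [[un1 vn1 un2 vn2] orient]] := frame p Dp.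
have [E0 g0] := spacelike_gram_gt0 hz Dp.
have tr1 := mink_mean_curvature hz Dp xy un1 vn1.
have tr2 := mink_mean_curvature hz Dp xy un2 vn2.
split=> [H0|[h1 h2]].
  by rewrite H0 !mink0l !mulr0 in tr1 tr2; exact (conj (esym tr1) (esym tr2)).
have vanish t : 2 * gram z p * t = 0 -> t = 0.
  by move/eqP; rewrite mulf_eq0 gt_eqF ?mulr_gt0// => /eqP.
have midpoint0 (a b n : 'rV[R]_4) : mink a n = 0 -> mink b n = 0 ->
    mink (2^-1 *: (a + b)) n = 0.
  by move=> an bn; rewrite mink_midpoint an bn addr0 mulr0.
have g_neq0 : gram z p != 0 by rewrite gt_eqF.
have [xu xv] := normal_part_orthogonal ('D_x (fun q => 'D_x z q) p) g_neq0.
have [yu yv] := normal_part_orthogonal ('D_y (fun q => 'D_y z q) p) g_neq0.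
exact (mink_nondegenerate orient (midpoint0 _ _ _ xu yu) (midpoint0 _ _ _ xv yv)
  (vanish _ (etrans tr1 h1)) (vanish _ (etrans tr2 h2))).
Qed.

Theorem proposition3p3 (R : realType) (D : set 'rV[R]_2)
    (z n1 n2 : 'rV[R]_2 -> 'rV[R]_4)
    (hz : spacelike_surface D z)
    (hn : normal_frame D z n1 n2)
    (hflat : forall p, D p -> ~ flat_point z n1 n2 p) :
  minimal_surface D z <->
  (forall p, D p -> inv_kappa z n1 n2 p ^+ 2 - inv_k z n1 n2 p = 0).
Proof.
have [_ sz _ _] := hz.
have pointwise p x y : D p -> orthonormal_tangent_frame z p x y ->
    mean_curvature z p x y = 0 <-> inv_kappa z n1 n2 p ^+ 2 - inv_k z n1 n2 p = 0.
  move=> Dp xy; apply: iff_trans (mean_curvature_eq0 hz hn Dp xy) _.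
  have [E0 g0] := spacelike_gram_gt0 hz Dp.
  by apply: trace_zero_iff => //; [rewrite sqrtr_gt0|exact: hflat].
split=> [minz p Dp|kk p x y Dp xy]; last exact/(pointwise p x y Dp xy)/kk.
have [E0 g0] := spacelike_gram_gt0 hz Dp.
have [x [y xy]] := orthonormal_tangent_frame_exists
  (smooth_on_differentiable sz Dp) E0 g0.
by apply/(pointwise p x y Dp xy); exact: minz.
Qed.
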